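(* Let $d\ge 1$ and let $A\colon\mathbb{Z}\to M_d(\mathbb{R})$ be such that every $A(n)$, $n\in\mathbb{Z}$, is non-singular and there is $M>0$ with $\sup_{n\in\mathbb{Z}}\max\{\|A(n)\|,\|A(n)^{-1}\|\}\le M$. Let $\Sigma(A)=[a_1,b_1]\cup\dots\cup[a_\ell,b_\ell]$ be the exponential dichotomy spectrum (on $\mathbb{Z}$) of the system $x_{n+1}=A(n)x_n$, written as its union of spectral intervals with $a_i\le b_i<a_{i+1}$, and let $\mathcal{W}_1,\dots,\mathcal{W}_\ell$ be the associated invariant vector bundles, with fibers $\mathcal{W}_i(n)$. Then for every $i\in\{1,\dots,\ell\}$ and every $\xi_i\in\mathcal{W}_i(0)\setminus\{0\}$, the upper Bohl exponent of the solution starting from $\xi_i$ at time $0$ satisfies $$\overline{\beta}_A(\xi_i)\in[a_i,b_i].$$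
   Context: Norms: $\|\cdot\|$ is a norm on $\mathbb{R}^d$ and the induced matrix norm on $M_d(\mathbb{R})$. Transition operator of $x_{n+1}=A(n)x_n$: $X(m,n)=A(m-1)\cdots A(n)$ if $m>n$, $X(m,m)=I$, and $X(m,n)=A(m)^{-1}\cdots A(n-1)^{-1}$ if $m<n$, for $m,n\in\mathbb{Z}$. Upper Bohl exponent: for $\xi\in\mathbb{R}^d\setminus\{0\}$, $$\overline{\beta}_A(\xi)=\limsup_{m,\,n-m\to+\infty}\left(\frac{\|X(n,0)\xi\|}{\|X(m,0)\xi\|}\right)^{\frac{1}{n-m}},$$ where $m,n$ are integers and the limsup is taken as both $m\to+\infty$ and $n-m\to+\infty$, i.e. it is $\lim_{N\to\infty}\sup\{\,\cdot\, : m\ge N,\ n-m\ge N\}$. Invariant projector: a map $P\colon\mathbb{Z}\to M_d(\mathbb{R})$ with $P(k)^2=P(k)$ and $P(k+1)A(k)=A(k)P(k)$ for all $k\in\mathbb{Z}$. Exponential dichotomy on $\mathbb{Z}$: the system $x_{n+1}=A(n)x_n$ has an exponential dichotomy on $\mathbb{Z}$ if there are an invariant projector $P$ and constants $K>0$, $\rho\in(0,1)$ such that, for $k,l\in\mathbb{Z}$, $\|X(k,l)P(l)\|\le K\rho^{k-l}$ if $k\ge l$, and $\|X(k,l)[I-P(l)]\|\le K\rho^{l-k}$ if $k\le l$. Spectrum and resolvent: $\Sigma(A)$ is the set of all $\gamma\in(0,+\infty)$ for which the system $x(n+1)=\frac1\gamma A(n)x(n)$ has no exponential dichotomy on $\mathbb{Z}$;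 the resolvent is $\rho(A)=(0,+\infty)\setminus\Sigma(A)$. Known fact: under the assumptions on $A$, $\Sigma(A)$ is a union of $\ell\le d$ closed intervals $[a_1,b_1]\cup\dots\cup[a_\ell,b_\ell]$ with $a_i\le b_i<a_{i+1}$ (the spectral intervals), and $\rho(A)=\rho_0(A)\cup\dots\cup\rho_\ell(A)$ with $\rho_0(A)=(0,a_1)$, $\rho_i(A)=(b_i,a_{i+1})$ for $1\le i<\ell$, and $\rho_\ell(A)=(b_\ell,+\infty)$. Invariant vector bundles: for $\gamma\in\rho(A)$, let $P_\gamma$ denote an invariant projector of the exponential dichotomy of $x(n+1)=\frac1\gamma A(n)x(n)$. Choose $\gamma_i\in\rho_i(A)$ for $i=0,\dots,\ell$. For $i=1,\dots,\ell$ and $n\in\mathbb{Z}$ the fibers are $\mathcal{W}_i(n)=\ker P_{\gamma_{i-1}}(n)\cap\operatorname{im}P_{\gamma_i}(n)$, and $\mathcal{W}_i=\bigcup_{n\in\mathbb{Z}}\{n\}\times\mathcal{W}_i(n)$. Known fact: these are independent of the choice of the $\gamma_i\in\rho_i(A)$. *)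

(* Defs.v *)
From HB Require Import structures.
From mathcomp Require Export all_boot all_order all_algebra.
From mathcomp Require Export all_classical all_reals all_analysis.

Set Implicit Arguments.
Unset Strict Implicit.
Unset Printing Implicit Defensive.

Import Order.TTheory GRing.Theory Num.Theory.
Import numFieldNormedType.Exports.

Local Open Scope classical_set_scope.
Local Open Scope ring_scope.

Record is_norm (R : realType) (d : nat) (N : 'cV[R]_d -> R) : Prop := IsNorm {
  is_norm_ge0 : forall x, 0 <= N x ;
  is_norm_eq0 : forall x, N x = 0 -> x = 0 ;
  is_normZ : forall (c : R) x, N (c *: x) = `|c| * N x ;
  is_normD : forall x y, N (x + y) <= N x + N y }.

(* The supremum is over a nonempty set that is bounded (finite dimension) as
   soon as N is a norm, so the real-valued [sup] is the genuine one. *)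
Definition opnorm (R : realType) (d : nat) (N : 'cV[R]_d -> R) (B : 'M[R]_d) : R :=
  sup [set N (B *m x) | x in [set x | N x <= 1]].

(* The products are taken from left to right:
   A(m-1) A(m-2) ... A(n) if n <= m, and A(m)^-1 A(m+1)^-1 ... A(n-1)^-1
   if m < n; the empty product for m = n is the identity. *)
Definition transition (R : realType) (d : nat) (A : int -> 'M[R]_d) (m n : int)
    : 'M[R]_d :=
  if n <= m then \big[mulmx/1%:M]_(0 <= j < `|m - n|%N) A (m - 1 - j%:Z)
  else \big[mulmx/1%:M]_(0 <= j < `|n - m|%N) invmx (A (m + j%:Z)).

Definition bohl_quotient (R : realType) (d : nat) (N : 'cV[R]_d -> R)
    (A : int -> 'M[R]_d) (xi : 'cV[R]_d) (m n : int) : R :=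
  (N (transition A n 0 *m xi) / N (transition A m 0 *m xi))
    `^ ((n - m)%:~R)^-1.

(* The suprema decrease with k, so the limit always exists in \bar R. *)
Definition upper_bohl (R : realType) (d : nat) (N : 'cV[R]_d -> R)
    (A : int -> 'M[R]_d) (xi : 'cV[R]_d) : \bar R :=
  limn (fun k : nat =>
    ereal_sup [set x : \bar R | exists m n : int,
      [/\ k%:Z <= m, k%:Z <= n - m & x = (bohl_quotient N A xi m n)%:E]]).

Definition invariant_projector (R : realType) (d : nat)
    (A P : int -> 'M[R]_d) : Prop :=
  forall k : int, P k *m P k = P k /\ P (k + 1) *m A k = A k *m P k.

Definition dichotomy_projector (R : realType) (d : nat) (N : 'cV[R]_d -> R)
    (A P : int -> 'M[R]_d) : Prop :=
  invariant_projector A P /\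
  exists K rho : R, [/\ 0 < K, 0 < rho, rho < 1 &
    forall k l : int,
      (l <= k -> opnorm N (transition A k l *m P l) <= K * rho ^ (k - l)) /\
      (k <= l ->
        opnorm N (transition A k l *m (1%:M - P l)) <= K * rho ^ (l - k))].

Definition exponential_dichotomy (R : realType) (d : nat) (N : 'cV[R]_d -> R)
    (A : int -> 'M[R]_d) : Prop :=
  exists P : int -> 'M[R]_d, dichotomy_projector N A P.

Definition rescale (R : realType) (d : nat) (g : R) (A : int -> 'M[R]_d)
    : int -> 'M[R]_d :=
  fun n => g^-1 *: A n.

Definition dichotomy_spectrum (R : realType) (d : nat) (N : 'cV[R]_d -> R)
    (A : int -> 'M[R]_d) : set R :=
  [set g : R | 0 < g /\ ~ exponential_dichotomy N (rescale g A)].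

(* Sequences a, b are used at the indices 1, ..., l only. *)
Definition is_spectral_decomposition (R : realType) (d : nat)
    (N : 'cV[R]_d -> R) (A : int -> 'M[R]_d) (l : nat) (a b : nat -> R) : Prop :=
  [/\ forall i : nat, (1 <= i <= l)%N -> a i <= b i,
      forall i : nat, (1 <= i < l)%N -> b i < a i.+1 &
      dichotomy_spectrum N A =
        \bigcup_(i in [set i : nat | (1 <= i <= l)%N]) `[a i, b i]%classic].

(* (0, a_1) for i = 0, (b_i, a_{i+1}) for 1 <= i < l, (b_l, +oo) for i = l. *)
Definition resolvent_interval (R : realType) (l : nat) (a b : nat -> R) (i : nat)
    : set R :=
  [set g : R | [/\ 0 < g, (1 <= i)%N -> b i < g & (i < l)%N -> g < a i.+1]].

(* P j, for j = 0, ..., l, is the projector P_{gamma_j}; here 1 <= i <= l. *)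
Definition bundle_fiber (R : realType) (d : nat) (P : nat -> int -> 'M[R]_d)
    (i : nat) (n : int) : set 'cV[R]_d :=
  [set x | P i.-1 n *m x = 0] `&` range (fun y : 'cV[R]_d => P i n *m y).

(* Main.v *)
Require Import Defs.
From HB Require Import structures.
From mathcomp Require Import zify ring.
Import Order.TTheory GRing.Theory Num.Theory.
Import numFieldNormedType.Exports.
Local Open Scope classical_set_scope.
Local Open Scope ring_scope.

Set Implicit Arguments.
Unset Strict Implicit.
Unset Printing Implicit Defensive.

(** Fix [t > 0] and let S(t) be the set of initial vectors [xi] whose forward
    orbit satisfies N(X(n,0) xi) <= C t^n for some constant C
    ([growth_at_most]). This set grows with t.

    Let [g] be in the resolvent, with projector [P] and dichotomy rate [rho].
    Forward contraction on the image of [P] gives im P(0) in S(rho g).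
    Conversely, contraction backward in time on the kernel of [P] bounds
    N(xi - P(0) xi) by a multiple of (rho / g)^n N(X(n,0) xi), so S(t) is
    contained in im P(0) as soon as rho t < g. Hence S is constant around [g]
    ([growth_at_most_projector]), and therefore constant on each interval of the
    resolvent ([growth_at_most_interval]). This is the only part of the
    independence of the bundles from the chosen [gamma] that is needed: the
    images im P_g(0) agree along a resolvent interval.

    Upper bound. If [xi] is in the fiber, then [xi] is in the image of the
    projector for [gamma i], hence in the image of the projector for every [g]
    of the i-th resolvent interval, in particular for [g] arbitrarily close to
    [b i]. The dichotomy estimate N(x_n) <= K (rho g)^(n-m) N(x_m) along the
    orbit makes the quotients at most [g] once K rho^(n-m) <= 1
    ([upper_bohl_le_projector]).

    Lower bound. If the exponent were below [a i], it would be below some [g] in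
    the resolvent interval that ends at [a i]. Then the orbit of [xi] grows at
    most like g^n ([growth_at_most_upper_bohl]), so [xi] is in S(g), which is
    the image of the projector for [gamma i.-1]. But [xi] is also in the kernel
    of that projector, so it would vanish. Thus the lower bound, too, uses
    forward orbits only.

    The induced matrix norm is a supremum of reals; that it really bounds
    N(B x) by a multiple of N(x) rests on the equivalence of norms in finite
    dimension ([le_opnorm]). *)

(** * Norms on a finite-dimensional space *)

Section FiniteDimensionalNorm.
Variables (R : realType) (d : nat) (N : 'cV[R]_d -> R).
Hypothesis hN : is_norm N.

Lemma is_norm0 : N 0 = 0.
Proof. by rewrite -(scale0r (0 : 'cV[R]_d)) (is_normZ hN) normr0 mul0r. Qed.

Lemma is_norm_gt0 x : x <> 0 -> 0 < N x.
Proof.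
move=> x0; rewrite lt_neqAle (is_norm_ge0 hN) andbT eq_sym.
by apply/eqP => /(is_norm_eq0 hN).
Qed.

Lemma is_norm_sum (I : Type) (r : seq I) (F : I -> 'cV[R]_d) :
  N (\sum_(i <- r) F i) <= \sum_(i <- r) N (F i).
Proof.
elim/big_ind2 : _ => // [|x1 x2 y1 y2 h1 h2]; first by rewrite is_norm0.
by apply: le_trans (is_normD hN _ _) _; exact: lerD.
Qed.

Lemma mx_norm_ge_entry (p q : nat) (x : 'M[R]_(p, q)) i j :
  `|x i j| <= mx_norm x.
Proof.
rewrite mx_normrE.
exact: (le_bigmax 0 (fun ij : 'I_p * 'I_q => `|x ij.1 ij.2|) (i, j)).
Qed.

(** Expansion on the columns of [B]. Used for all [B] to bound the set that
    defines [opnorm], and for the identity to get continuity of the norm. Rows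
    are used because compactness of closed bounded sets is a result about row
    vectors. *)
Lemma is_norm_mulmx_le (B : 'M[R]_d) (x : 'rV[R]_d) :
  N (B *m x^T) <= (\sum_j N (col j B)) * mx_norm x.
Proof.
have -> : B *m x^T = \sum_j x 0 j *: col j B.
  apply/colP => k; rewrite !mxE summxE; apply: eq_bigr => j _.
  by rewrite !mxE mulrC.
apply: le_trans (is_norm_sum _ _) _.
rewrite mulr_suml; apply: ler_sum => j _.
rewrite (is_normZ hN) mulrC ler_wpM2l ?(is_norm_ge0 hN)//.
exact: mx_norm_ge_entry.
Qed.

Lemma is_norm_continuous : continuous (fun x : 'rV[R]_d => N x^T).
Proof.
pose C := \sum_j N (col j (1%:M : 'M[R]_d)) + 1.
have C0 : 0 < C.
  by rewrite ltr_wpDl// sumr_ge0// => j _; exact: (is_norm_ge0 hN).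
have lip (u v : 'rV[R]_d) : N u^T - N v^T <= C * `|u - v|.
  have := is_norm_mulmx_le 1%:M (u - v); rewrite mul1mx => h.
  rewrite lerBlDr (_ : u^T = (u - v)^T + v^T); last first.
    by rewrite -raddfD /= subrK.
  apply: le_trans (is_normD hN _ _) _; rewrite lerD2r.
  apply: le_trans h _; apply: ler_wpM2r; first exact: (normr_ge0 (u - v)).
  by rewrite lerDl.
move=> x; apply/(@cvgrPdist_le _ _ _ _ (nbhs_filter x)) => e e0.
apply/nbhs_ballP; exists (e / C) => /=; first exact: divr_gt0.
move=> y; rewrite -ball_normE /= => xy.
have {}xy : C * `|x - y| <= e by rewrite mulrC -ler_pdivlMr// ltW.
rewrite ler_norml lerNl opprB (le_trans (lip _ _) _) ?(le_trans (lip _ _) _)//.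
by rewrite distrC.
Qed.

(** The norm is positive and continuous, hence has a positive minimum on the
    unit sphere of the max norm, which is compact; homogeneity does the rest. *)
Lemma is_norm_ge_mx_norm :
  exists2 c : R, 0 < c & forall x : 'rV[R]_d, c * mx_norm x <= N x^T.
Proof.
have [[x0 x00]|/forallNP triv] :=
    pselect (exists x : 'rV[R]_d, x <> 0); last first.
  exists 1 => // x; have /contrapT -> := triv x.
  by rewrite mx_norm0 mulr0 (is_norm_ge0 hN).
pose S := [set x : 'rV[R]_d | `|x| = 1].
have unitS (x : 'rV[R]_d) : x != 0 -> S (`|x|^-1 *: x).
  move=> x_neq0; rewrite /S /= normrZ normfV normr_id mulVf//.
  by rewrite normr_eq0.
have cS : compact S.
  apply: bounded_closed_compact.
    by exists 1; split=> // t t1 y /= ->; exact: ltW.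
  rewrite (_ : S = (fun x : 'rV[R]_d => `|x|) @^-1` [set 1])//.
  apply: closed_comp; last exact: closed_eq.
  by move=> y _; exact: norm_continuous.
have S0 : S !=set0 by exists (`|x0|^-1 *: x0); apply: unitS; exact/eqP.
have [y /set_mem Sy ymin] := compact_EVT_min S0 cS
   (@continuous_subspaceT _ _ _ _ is_norm_continuous).
exists (N y^T).
  apply: is_norm_gt0 => yT0; move: Sy; rewrite /S /= -(trmxK y) yT0.
  by rewrite trmx0 normr0 => /esym/eqP; rewrite oner_eq0.
move=> x; have [->|x_neq0] := eqVneq x 0.
  by rewrite mx_norm0 mulr0 (is_norm_ge0 hN).
have := ymin _ (mem_set (unitS _ x_neq0)).
rewrite linearZ /= (is_normZ hN) normfV normr_id mulrC ler_pdivlMr//.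
by rewrite normr_gt0.
Qed.

(** The point is that the set defining [opnorm] is bounded: otherwise its real
    supremum would be the default value 0. *)
Lemma le_opnorm (B : 'M[R]_d) (x : 'cV[R]_d) :
  N (B *m x) <= opnorm N B * N x.
Proof.
have [->|x0] := eqVneq x 0; first by rewrite mulmx0 is_norm0 mulr0.
have Nx : 0 < N x by apply: is_norm_gt0; exact/eqP.
have [c c0 hc] := is_norm_ge_mx_norm.
rewrite -ler_pdivrMr// /opnorm; apply: ub_le_sup.
  exists ((\sum_j N (col j B)) / c) => _ [y /= y1 <-].
  rewrite -(trmxK y); apply: le_trans (is_norm_mulmx_le _ _) _.
  rewrite ler_wpM2l ?sumr_ge0// => [j _|]; first exact: (is_norm_ge0 hN).
  by rewrite -div1r ler_pdivlMr// mulrC (le_trans (hc _))// trmxK.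
exists ((N x)^-1 *: x) => /=.
  by rewrite (is_normZ hN) normfV gtr0_norm// mulVf// gt_eqF.
by rewrite -scalemxAr (is_normZ hN) normfV gtr0_norm// mulrC.
Qed.

End FiniteDimensionalNorm.

(** * Transition operators *)

(** For splitting products over [mulmx] at their last factor. *)
HB.instance Definition _ (R : pzSemiRingType) (n : nat) :=
  Monoid.isLaw.Build 'M[R]_n 1%:M (@mulmx R n n n)
    (@mulmxA R n n n n) (@mul1mx R n n) (@mulmx1 R n n).

Section Transition.
Variables (R : realType) (d : nat).
Implicit Types (A P : int -> 'M[R]_d) (m : int) (k : nat).

Lemma transition_nn A m : transition A m m = 1%:M.
Proof. by rewrite /transition lexx subrr big_geq. Qed.

Lemma transitionSl A m k :
  transition A (m + k.+1%:Z) m = A (m + k%:Z) *m transition A (m + k%:Z) m.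
Proof.
have subK j : `|(m + j%:Z - m)%R|%N = j by rewrite addrAC subrr add0r.
rewrite /transition !lerDl !lez_nat /= !subK.
rewrite big_nat_recl//; congr (A _ *m _); first by rewrite intS; lia.
by apply: eq_bigr => j _; congr (A _); rewrite !intS; lia.
Qed.

(** Backward in time the products grow on the right, in the opposite order to
    [transitionSl]; this is what makes the two products mutually inverse. *)
Lemma transition_invSr A m k :
  transition A m (m + k.+1%:Z) = transition A m (m + k%:Z) *m invmx (A (m + k%:Z)).
Proof.
have inv_prod j : transition A m (m + j%:Z) =
    \big[mulmx/1%:M]_(0 <= i < j) invmx (A (m + i%:Z)).
  case: j => [|j]; first by rewrite addr0 transition_nn big_geq.
  rewrite /transition gerDl lez_nat /= [_ - m]addrAC subrr add0r.
  by rewrite absz_nat.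
by rewrite !inv_prod big_nat_recr.
Qed.

Lemma transition_cocycle A (m k : nat) :
  transition A (m + k)%N 0 = transition A (m%:Z + k%:Z) m *m transition A m 0.
Proof.
elim: k => [|k IH]; first by rewrite addn0 addr0 transition_nn mul1mx.
rewrite transitionSl -mulmxA -[m%:Z + k%:Z]/((m + k)%N%:Z) -IH.
by rewrite -[X in transition A X 0]add0r addnS transitionSl add0r.
Qed.

Lemma transitionK A m k : (forall n, A n \in unitmx) ->
  transition A m (m + k%:Z) *m transition A (m + k%:Z) m = 1%:M.
Proof.
move=> hA; elim: k => [|k IH]; first by rewrite addr0 !transition_nn mul1mx.
rewrite transition_invSr transitionSl -mulmxA.
by rewrite (mulKmx (hA _)).
Qed.

Lemma transition_projector A P m k : invariant_projector A P ->
  P (m + k%:Z) *m transition A (m + k%:Z) m =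
  transition A (m + k%:Z) m *m P m.
Proof.
move=> hP; elim: k => [|k IH]; first by rewrite addr0 !transition_nn mulmx1 mul1mx.
rewrite transitionSl -[RHS]mulmxA -IH !mulmxA -(hP _).2.
by congr (P _ *m _ *m _); rewrite intS; lia.
Qed.

Lemma transition_rescale A g m k :
  transition (rescale g A) (m + k%:Z) m = g ^- k *: transition A (m + k%:Z) m.
Proof.
elim: k => [|k IH]; first by rewrite addr0 !transition_nn expr0 invr1 scale1r.
rewrite !transitionSl IH /rescale -scalemxAl -scalemxAr scalerA.
by rewrite exprS invfM mulrC.
Qed.

Lemma rescale_unitmx A g : g != 0 -> (forall n, A n \in unitmx) ->
  forall n, rescale g A n \in unitmx.
Proof. by move=> g0 hA n; rewrite /rescale unitmxZ ?unitfE ?invr_eq0 ?hA. Qed.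

End Transition.

(** * Growth of forward orbits under a dichotomy *)

Section Dichotomy.
Variables (R : realType) (d : nat) (N : 'cV[R]_d -> R).
Hypothesis hN : is_norm N.
Implicit Types (A P : int -> 'M[R]_d) (xi : 'cV[R]_d).

(** Only forward orbits appear. The estimate on the image of [P] is the first
    half of the dichotomy; the second half, from time n back to time 0, is
    applied to the component (1 - P(n)) x_n of the orbit, which is carried back
    to xi - P(0) xi. *)
Lemma dichotomy_orbit_estimates A P :
  (forall n, A n \in unitmx) -> dichotomy_projector N A P ->
  exists K rho : R, [/\ 0 < K, 0 < rho < 1,
    forall xi (m k : nat), P 0 *m xi = xi ->
      N (transition A (m + k)%N 0 *m xi) <=
        K * rho ^+ k * N (transition A m 0 *m xi) &
    forall xi (n : nat),
      N (xi - P 0 *m xi) <= K * rho ^+ n * N (transition A n 0 *m xi)].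
Proof.
move=> hA [Pinv [K [rho [K0 rho0 rho1 hP]]]].
exists K, rho; split; rewrite ?rho0//.
- move=> xi m k Pxi.
  have Pm : P m *m (transition A m 0 *m xi) = transition A m 0 *m xi.
    have := transition_projector 0 m Pinv.
    by rewrite add0r mulmxA => ->; rewrite -mulmxA Pxi.
  rewrite transition_cocycle -mulmxA -{1}Pm mulmxA.
  apply: le_trans (le_opnorm hN _ _) _.
  rewrite ler_wpM2r ?(is_norm_ge0 hN)//.
  have [+ _] := hP (m%:Z + k%:Z) m.
  by rewrite lerDl [_ - m%:Z]addrAC subrr add0r; exact.
- move=> xi n.
  have -> : xi - P 0 *m xi =
      transition A 0 n *m (1%:M - P n) *m (transition A n 0 *m xi).
    have := transition_projector 0 n Pinv; have := transitionK 0 n hA.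
    rewrite add0r => XK PX.
    rewrite -!mulmxA [(1%:M - P n) *m _]mulmxBl mul1mx [P n *m _]mulmxA PX.
    by rewrite -mulmxA -mulmxBr mulmxA XK mul1mx.
  apply: le_trans (le_opnorm hN _ _) _.
  rewrite ler_wpM2r ?(is_norm_ge0 hN)//.
  have [_] := hP 0 n.
  by rewrite subr0; exact.
Qed.

(** The same estimates read on the original system: orbits of the rescaled
    system are those of [A] divided by g^n. *)
Lemma resolvent_orbit_estimates A P g :
  (forall n, A n \in unitmx) -> 0 < g -> dichotomy_projector N (rescale g A) P ->
  exists K rho : R, [/\ 0 < K, 0 < rho < 1,
    forall xi (m k : nat), P 0 *m xi = xi ->
      N (transition A (m + k)%N 0 *m xi) <=
        K * (rho * g) ^+ k * N (transition A m 0 *m xi) &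
    forall xi (n : nat),
      N (xi - P 0 *m xi) <= K * (rho / g) ^+ n * N (transition A n 0 *m xi)].
Proof.
move=> hA g0 hP.
have hgA := rescale_unitmx (lt0r_neq0 g0) hA.
have [K [rho [K0 rho01 stab unst]]] := dichotomy_orbit_estimates hgA hP.
have orbitE (n : nat) xi : N (transition (rescale g A) n 0 *m xi) =
    g ^- n * N (transition A n 0 *m xi).
  have := transition_rescale A g 0 n; rewrite add0r => ->.
  by rewrite -scalemxAl (is_normZ hN) ger0_norm// invr_ge0 exprn_ge0// ltW.
exists K, rho; split=> // [xi m k Pxi|xi n]; last first.
  by have := unst xi n; rewrite orbitE exprMn exprVn !mulrA.
have := stab xi m k Pxi; rewrite !orbitE ler_pdivrMl ?exprn_gt0//.
move/le_trans; apply; rewrite exprD exprMn le_eqVlt; apply/orP; left.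
apply/eqP; have gm0 : g ^+ m != 0 by rewrite expf_neq0// gt_eqF.
by field.
Qed.

Definition growth_at_most A xi (t : R) :=
  exists C, forall n : nat, N (transition A n 0 *m xi) <= C * t ^+ n.

Lemma growth_at_most_ge0 A xi t :
  growth_at_most A xi t ->
  exists2 C, 0 <= C & forall n : nat, N (transition A n 0 *m xi) <= C * t ^+ n.
Proof.
move=> [C hC]; exists C => //.
by have := hC 0%N; rewrite expr0 mulr1; apply: le_trans; exact: is_norm_ge0.
Qed.

Lemma growth_at_most_le A xi s t : 0 <= s -> s <= t ->
  growth_at_most A xi s -> growth_at_most A xi t.
Proof.
move=> s0 st /growth_at_most_ge0[C C0 hC]; exists C => n.
by rewrite (le_trans (hC n))// ler_wpM2l// lerXn2r// nnegrE// (le_trans s0).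
Qed.

Lemma le_geometric_eq0 (c D q : R) : 0 <= q -> q < 1 -> 0 <= c ->
  (forall n : nat, c <= D * q ^+ n) -> c = 0.
Proof.
move=> q0 q1 c0 hc; apply/eqP; rewrite eq_le c0 andbT.
have cvg0 : geometric D q @ \oo --> 0.
  by apply: cvg_geometric; rewrite ger0_norm.
rewrite -(cvg_lim (@Rhausdorff R) cvg0); apply: limr_ge.
  by apply/cvg_ex; exists 0.
exact: nearW.
Qed.

(** The two inclusions S(t) in im P(0), for t < g / rho, and
    im P(0) in S(rho g). They cover a neighbourhood of [g] because rho < 1. *)
Lemma growth_at_most_projector A P g :
  (forall n, A n \in unitmx) -> 0 < g -> dichotomy_projector N (rescale g A) P ->
  exists2 rho : R, 0 < rho < 1 & forall xi,
    (forall t, 0 <= t -> rho * t < g ->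
       growth_at_most A xi t -> P 0 *m xi = xi) /\
    (P 0 *m xi = xi -> growth_at_most A xi (rho * g)).
Proof.
move=> hA g0 hP.
have [K [rho [K0 rho01 stab unst]]] := resolvent_orbit_estimates hA g0 hP.
exists rho => // xi; split=> [t t0 rtg [C hC]|Pxi]; last first.
  exists (K * N xi) => n; have := stab xi 0%N n Pxi.
  by rewrite add0n transition_nn mul1mx mulrAC.
have /andP[rho0 _] := rho01.
apply/esym/eqP; rewrite -subr_eq0; apply/eqP/(is_norm_eq0 hN).
apply: (@le_geometric_eq0 _ (K * C) (rho / g * t)) => [|||n].
- by rewrite mulr_ge0// divr_ge0 ?ltW.
- by rewrite mulrAC ltr_pdivrMr// mul1r.
- exact: is_norm_ge0.
apply: le_trans (unst xi n) _.
rewrite [(_ * t) ^+ n]exprMn mulrACA ler_wpM2l//.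
by rewrite mulr_ge0 ?exprn_ge0 ?divr_ge0 ?ltW.
Qed.

(** Connectedness argument. Let [c] be the infimum of the rates in [s, t] that
    are admissible for [xi]. Since [c] is in the resolvent, an admissible rate
    slightly above [c] puts [xi] in the image of the projector at [c], so the
    rate rho c < c is admissible as well; this forces rho c <= s. *)
Lemma growth_at_most_resolvent A xi (s t : R) :
  (forall n, A n \in unitmx) -> 0 < s ->
  (forall g, s <= g <= t -> exponential_dichotomy N (rescale g A)) ->
  growth_at_most A xi t -> s <= t -> growth_at_most A xi s.
Proof.
move=> hA s0 hres ht st.
pose E := [set g | s <= g <= t /\ growth_at_most A xi g].
have Et : E t by rewrite /E /= st lexx.
have lbE : lbound E s by move=> g [/andP[]].
have infE : has_inf E by split; [exists t | exists s].
pose c := inf E.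
have sc : s <= c by apply: lb_le_inf => //; exists t.
have ct : c <= t by apply: ge_inf => //; exists s.
have c0 : 0 < c := lt_le_trans s0 sc.
have [|P hP] := hres c; first by rewrite sc ct.
have [rho /andP[rho0 rho1] /(_ xi)[into out]] := growth_at_most_projector hA c0 hP.
have rcc : rho * c < c by rewrite gtr_pMl.
(* An admissible rate g below c / rho exists, as c is the infimum. *)
have [|g [/andP[sg gt] hg] gc] := @inf_adherent _ E (c / rho - c) _ infE.
  by rewrite subr_gt0 ltr_pdivlMr// mulrC.
move: gc; rewrite -/c addrC subrK ltr_pdivlMr// mulrC => gc.
have /out hrc := into g (ltW (lt_le_trans s0 sg)) gc hg.
have rc0 : 0 <= rho * c by rewrite mulr_ge0 ?ltW.
have [rcs|src] := leP (rho * c) s; first exact: growth_at_most_le hrc.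
have : E (rho * c) by split=> //; rewrite (ltW src) (le_trans (ltW rcc) ct).
by move/(ge_inf infE.2); rewrite leNgt rcc.
Qed.

Lemma growth_at_most_interval A xi (s t : R) :
  (forall n, A n \in unitmx) -> 0 < s -> 0 < t ->
  (forall g, Num.min s t <= g <= Num.max s t ->
     exponential_dichotomy N (rescale g A)) ->
  growth_at_most A xi t -> growth_at_most A xi s.
Proof.
move=> hA s0 t0; have [st|ts] := leP s t => hres ht.
  exact: growth_at_most_resolvent hres ht st.
exact: growth_at_most_le (ltW t0) (ltW ts) ht.
Qed.

(** * Tail suprema and quotients of the Bohl exponent *)

(** The tail suprema are nonincreasing, so the limit that defines the exponent
    exists and is their infimum. *)
Lemma upper_bohlE A xi : upper_bohl N A xi =
  ereal_inf (range (fun k : nat =>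
    ereal_sup [set x : \bar R | exists m n : int,
      [/\ k%:Z <= m, k%:Z <= n - m & x = (bohl_quotient N A xi m n)%:E]])).
Proof.
apply: (cvg_lim (@ereal_hausdorff R)); apply: ereal_nonincreasing_cvgn.
move=> j k jk; apply: ereal_sup_le => _ [m [n [km kn ->]]].
by exists m, n; split=> //; [apply: le_trans km|apply: le_trans kn].
Qed.

Lemma upper_bohl_le A xi (g : R) (k : nat) :
  (forall m p : nat, (k <= m)%N -> (k <= p)%N ->
     bohl_quotient N A xi m (m + p)%N <= g) ->
  (upper_bohl N A xi <= g%:E)%E.
Proof.
move=> hk; rewrite upper_bohlE; apply: ge_ereal_inf; eexists; first by exists k.
apply: ge_ereal_sup => _ [m [n [km kn ->]]]; rewrite lee_fin.
have [m' mE] : exists m' : nat, m = m'%:Z by exists `|m|%N; lia.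
have [p pE] : exists p : nat, n - m = p%:Z by exists `|n - m|%N; lia.
have -> : n = (m' + p)%N%:Z by lia.
by rewrite mE; apply: hk; lia.
Qed.

Lemma upper_bohl_lt A xi g : (upper_bohl N A xi < g%:E)%E ->
  exists k : nat, forall m p : nat, (k <= m)%N -> (k <= p)%N ->
    bohl_quotient N A xi m (m + p)%N <= g.
Proof.
rewrite upper_bohlE => /ereal_inf_lt[_ [k _ <-] hk]; exists k => m p km kp.
rewrite -lee_fin; apply: le_trans (ltW hk); apply: ereal_sup_ubound.
by exists m, (m + p)%N; split=> //; lia.
Qed.

Lemma orbit_gt0 A xi (n : nat) : (forall n, A n \in unitmx) -> xi <> 0 ->
  0 < N (transition A n 0 *m xi).
Proof.
move=> hA xi0; apply: is_norm_gt0 => // x0; apply: xi0.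
by rewrite -[xi]mul1mx -(transitionK 0 n hA) add0r -mulmxA x0 mulmx0.
Qed.

Lemma bohl_quotient_le A xi (g : R) (m p : nat) :
  (forall n, A n \in unitmx) -> xi <> 0 -> 0 < g -> (0 < p)%N ->
  (bohl_quotient N A xi m (m + p)%N <= g) =
  (N (transition A (m + p)%N 0 *m xi) <= g ^+ p * N (transition A m 0 *m xi)).
Proof.
move=> hA xi0 g0 p0; rewrite /bohl_quotient.
have -> : (m + p)%N%:Z - m%:Z = p%:Z by lia.
rewrite -ler_pdivrMr; last exact: orbit_gt0.
set q := _ / _; have q0 : 0 <= q by rewrite divr_ge0// is_norm_ge0.
rewrite -[in LHS](@ler_pXn2r _ p)// ?nnegrE ?powR_ge0 ?(ltW g0)//.
by rewrite -[(_ `^ _) ^+ p]powR_mulrn ?powR_ge0// -powRrM mulVf ?powRr1// intr_eq0; lia.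
Qed.

End Dichotomy.

(** * Spectral and resolvent intervals *)

Section SpectralIntervals.
Variables (R : realType) (d : nat) (N : 'cV[R]_d -> R) (A : int -> 'M[R]_d).
Variables (l : nat) (a b : nat -> R).
Hypothesis hspec : is_spectral_decomposition N A l a b.

Lemma spectral_intervals_lt i j :
  (1 <= i)%N -> (i < j)%N -> (j <= l)%N -> b i < a j.
Proof.
move=> i1; have [hab hba _] := hspec.
elim: j => // j IH; rewrite ltnS leq_eqVlt => /predU1P[<-|ij] jl.
  by apply: hba; rewrite i1.
apply: (lt_trans (IH ij (ltnW jl))).
by apply: le_lt_trans (hab j _) (hba j _); lia.
Qed.

Lemma resolvent_dichotomy j g : (j <= l)%N -> resolvent_interval l a b j g ->
  exponential_dichotomy N (rescale g A).
Proof.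
move=> jl [g0 gb ga]; have [hab _ hS] := hspec; apply: contrapT => nd.
have : dichotomy_spectrum N A g by [].
rewrite hS => -[k /= kl]; rewrite in_itv /= => /andP[ag gbk].
have [k1 kl'] := andP kl.
have [kj|jk] := leqP k j.
  have gbj : b j < g by apply: gb; lia.
  have bkj : b k <= b j.
    move: kj; rewrite leq_eqVlt => /predU1P[->//|kj].
    by apply: le_trans (ltW (spectral_intervals_lt k1 kj jl)) (hab _ _); lia.
  by move: (lt_le_trans gbj (le_trans gbk bkj)); rewrite ltxx.
have gaj : g < a j.+1 by apply: ga; lia.
have ajk : a j.+1 <= a k.
  move: jk; rewrite leq_eqVlt => /predU1P[->//|jk].
  by apply: le_trans (hab _ _) (ltW (spectral_intervals_lt _ jk kl')); lia.
by move: (lt_le_trans gaj (le_trans ajk ag)); rewrite ltxx.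
Qed.

Lemma resolvent_interval_between j s t g :
  resolvent_interval l a b j s -> resolvent_interval l a b j t ->
  Num.min s t <= g <= Num.max s t -> resolvent_interval l a b j g.
Proof.
move=> [s0 sb sa] [t0 tb ta] /andP[+ +].
rewrite ge_min le_max => lo hi.
split=> [|j1|jl].
- by case/orP: lo; exact: lt_le_trans.
- by move: (sb j1) (tb j1) => {}sb {}tb; case/orP: lo; exact: lt_le_trans.
- by move: (sa jl) (ta jl) => {}sa {}ta; case/orP: hi => /le_lt_trans; apply.
Qed.

(** Endpoints belong to the spectrum, which consists of positive numbers. *)
Lemma spectral_interval_gt0 i : (1 <= i <= l)%N -> 0 < a i.
Proof.
move=> il; have [hab _ hS] := hspec.
have : dichotomy_spectrum N A (a i); last by case.
by rewrite hS; exists i => //=; rewrite in_itv /= lexx hab.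
Qed.

End SpectralIntervals.

(** * Bounds on the upper Bohl exponent *)

Section BohlBounds.
Variables (R : realType) (d : nat) (N : 'cV[R]_d -> R).
Hypothesis hN : is_norm N.
Implicit Types (A P : int -> 'M[R]_d) (xi : 'cV[R]_d).

(** Along an orbit in the image of the projector the quotient is at most
    (K rho^p)^(1/p) g with p = n - m, and K rho^p <= 1 for large p. *)
Lemma upper_bohl_le_projector A P xi g :
  (forall n, A n \in unitmx) -> 0 < g -> dichotomy_projector N (rescale g A) P ->
  xi <> 0 -> P 0 *m xi = xi -> (upper_bohl N A xi <= g%:E)%E.
Proof.
move=> hA g0 hP xi0 Pxi.
have [K [rho [K0 /andP[rho0 rho1] stab _]]] := resolvent_orbit_estimates hN hA g0 hP.
have [k hk] : exists k : nat, forall p : nat, (k <= p)%N -> K * rho ^+ p <= 1.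
  have /cvgrPdist_le /(_ 1 ltr01)[k _ hk] : geometric K rho @ \oo --> 0.
    by apply: cvg_geometric; rewrite gtr0_norm.
  exists k => p kp; have := hk p kp.
  by rewrite /= sub0r normrN ger0_norm// mulr_ge0 ?exprn_ge0 ?ltW.
apply: (@upper_bohl_le _ _ _ _ _ _ k.+1) => m p _ kp.
rewrite (bohl_quotient_le hN)//; last exact: leq_trans kp.
apply: le_trans (stab xi m p Pxi) _.
rewrite ler_wpM2r ?(is_norm_ge0 hN)// exprMn mulrA.
by rewrite ler_piMl ?hk ?exprn_ge0 ?(ltW g0) ?(ltnW kp).
Qed.

(** An exponent below [g] bounds N(x_n) by g^(n-k) N(x_k) for a fixed [k] and
    all n >= 2k; the finitely many earlier times only affect the constant. *)
Lemma growth_at_most_upper_bohl A xi g :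
  (forall n, A n \in unitmx) -> xi <> 0 -> 0 < g ->
  (upper_bohl N A xi < g%:E)%E -> growth_at_most N A xi g.
Proof.
move=> hA xi0 g0 /upper_bohl_lt[k hk].
pose x (n : nat) := N (transition A n 0 *m xi).
have x0 n : 0 <= x n by exact: is_norm_ge0.
(* A sum over the times n <= 2k rather than a maximum; it covers time k too. *)
pose C := \sum_(n < k.*2.+1) x n / g ^+ n.
have termC n : (n < k.*2.+1)%N -> x n <= C * g ^+ n.
  move=> nk; rewrite -ler_pdivrMr ?exprn_gt0// /C (bigD1 (Ordinal nk))//= lerDl.
  by rewrite sumr_ge0// => j _; rewrite divr_ge0// exprn_ge0// ltW.
exists C => n; have [/termC//|nk] := ltnP n k.*2.+1.
have kn : (k <= n)%N by lia.
have := hk k (n - k)%N (leqnn k).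
rewrite (bohl_quotient_le hN)//; last by lia.
rewrite subnKC// => /(_ _)/le_trans; apply; first by lia.
have xk : x k <= C * g ^+ k by apply: termC; lia.
apply: le_trans (ler_wpM2l _ xk) _; first by rewrite exprn_ge0// ltW.
by rewrite mulrCA -exprD subnK.
Qed.

End BohlBounds.

Theorem theorem1 (R : realType) (d : nat) (hd : (1 <= d)%N)
  (N : 'cV[R]_d -> R) (hN : is_norm N)
  (A : int -> 'M[R]_d) (hA : forall n : int, A n \in unitmx)
  (M : R) (hM : 0 < M)
  (hAM : forall n : int,
     Num.max (opnorm N (A n)) (opnorm N (invmx (A n))) <= M)
  (l : nat) (a b : nat -> R)
  (hspec : is_spectral_decomposition N A l a b)
  (gamma : nat -> R)
  (hgamma : forall j : nat, (j <= l)%N -> resolvent_interval l a b j (gamma j))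
  (P : nat -> int -> 'M[R]_d)
  (hP : forall j : nat, (j <= l)%N ->
     dichotomy_projector N (rescale (gamma j) A) (P j))
  (i : nat) (hi : (1 <= i <= l)%N)
  (xi : 'cV[R]_d) (hxi : bundle_fiber P i 0 xi) (hxi0 : xi <> 0) :
  ((a i)%:E <= upper_bohl N A xi <= (b i)%:E)%E.
Proof.
have [i1 il] := andP hi.
have [hab hba _] := hspec.
have ai0 := spectral_interval_gt0 hspec hi.
have bi0 : 0 < b i := lt_le_trans ai0 (hab i hi).
case: hxi => /= ker_xi [y _ im_xi].
have transport j s t : (j <= l)%N -> resolvent_interval l a b j s ->
    resolvent_interval l a b j t ->
    growth_at_most N A xi t -> growth_at_most N A xi s.
  move=> jl hs ht; apply: (growth_at_most_interval hN) => //.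
  - by case: hs.
  - by case: ht.
  - move=> g /(resolvent_interval_between hs ht).
    exact: (resolvent_dichotomy hspec jl).
apply/andP; split.
- rewrite leNgt; apply/negP => lt_ai.
  have il1 : (i.-1 <= l)%N by lia.
  have g1_res := hgamma _ il1; have [g10 g1b g1a] := g1_res.
  have g1ai : gamma i.-1 < a i by move: g1a; rewrite prednK//; apply; lia.
  (* A rate strictly between the exponent and a i, in the resolvent. *)
  have [g [bohl_g lo_g g_ai]] : exists g,
      [/\ (upper_bohl N A xi < g%:E)%E, gamma i.-1 < g & g < a i].
    case: upper_bohl lt_ai => [r| |]//; rewrite ?lte_fin => r_ai.
    + have [] := midf_lt (_ : Num.max r (gamma i.-1) < a i).
        by rewrite gt_max r_ai.
      rewrite gt_max => /andP[r_mid g1_mid] mid_ai.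
      by eexists; split; [rewrite lte_fin; exact: r_mid|exact: g1_mid|].
    + have [g1_mid mid_ai] := midf_lt g1ai.
      by eexists; split; [exact: ltNyr|exact: g1_mid|].
  have g0 : 0 < g := lt_trans g10 lo_g.
  have g_res : resolvent_interval l a b i.-1 g.
    split=> // [h|_]; last by rewrite prednK.
    exact: lt_trans (g1b h) lo_g.
  have hg := growth_at_most_upper_bohl hN hA hxi0 g0 bohl_g.
  have hg1 := transport _ _ _ il1 g1_res g_res hg.
  have [rho /andP[_ rho1] /(_ xi)[into _]] :=
    growth_at_most_projector hN hA g10 (hP _ il1).
  apply: hxi0; rewrite -(into _ (ltW g10) _ hg1) ?ker_xi//.
  by rewrite gtr_pMl.
- apply/lee_addgt0Pr => e e0.
  have gi_res := hgamma _ il; have [gi0 gib gia] := gi_res.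
  have Pxi : P i 0 *m xi = xi.
    by rewrite -im_xi mulmxA; have [+ _] := hP _ il; move/(_ 0) => -[-> _].
  have [rho /andP[rho0 rho1] /(_ xi)[_ /(_ Pxi) hrho]] :=
    growth_at_most_projector hN hA gi0 (hP _ il).
  have hgi : growth_at_most N A xi (gamma i).
    by apply: growth_at_most_le hrho; rewrite ?mulr_ge0 ?ltW// gtr_pMl.
  (* Within e of b i, and still in the i-th resolvent interval. *)
  pose g := Num.min (gamma i) (b i + e).
  have big : b i < g by rewrite lt_min gib//= ltrDl.
  have g0 : 0 < g := lt_trans bi0 big.
  have g_res : resolvent_interval l a b i g.
    by split=> // il'; rewrite gt_min gia.
  have hg := transport _ _ _ il g_res gi_res hgi.
  have [Q hQ] := resolvent_dichotomy hspec il g_res.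
  have [r /andP[_ r1] /(_ xi)[into _]] := growth_at_most_projector hN hA g0 hQ.
  have Qxi : Q 0 *m xi = xi by apply: into hg; rewrite ?ltW// gtr_pMl.
  apply: le_trans (upper_bohl_le_projector hN hA g0 hQ hxi0 Qxi) _.
  by rewrite -EFinD lee_fin ge_min lexx orbT.
Qed.
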